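(* There exists a universal constant $c>0$ such that the following holds. Let $f:\mathbb{R}^d\to\mathbb{R}$ be differentiable with minimizer $x^*$, and let $g(x,\xi)$ be a stochastic gradient of $f$. Suppose that: (i) $f$ is $L$-smooth: $\|\nabla f(x)-\nabla f(y)\|_2\le L\|x-y\|_2$ for all $x,y\in\mathbb{R}^d$; (ii) $f$ is $\mu$-strongly convex ($\mu>0$): $f(y)\ge f(x)+\langle\nabla f(x),y-x\rangle+\frac{\mu}{2}\|x-y\|_2^2$ for all $x,y\in\mathbb{R}^d$; (iii) $\mathbb{E}_\xi[g(x,\xi)]=\nabla f(x)$ for all $x\in\mathbb{R}^d$; (iv) for some constant $\sigma^2>0$, $\mathbb{E}_\xi\left[\exp\left(\|g(x,\xi)-\nabla f(x)\|_2^2/\sigma^2\right)\right]\le\exp(1)$ for all $x\in\mathbb{R}^d$. Let $\kappa:=L/\mu$ and let $\delta\in(0,1)$. Run Batched SGD on $T=KH$ samples with $K=4\kappa\log T$ batches and step-size $\alpha=1/(2L)$, and set $r^{(k)}:=f(x^{(k)})-f(x^* )$. Then, with probability at least $1-\delta$, $$r^{(K)}\le\frac{r^{(0)}}{T}+\frac{16c^2\kappa\sigma^2}{\mu T}\log T\,\log\frac{2dT}{\delta}.$$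
   Context: Batched SGD: let $\xi_0,\xi_1,\dots,\xi_{T-1}$ be i.i.d. random variables distributed as $\xi$. The $T$ samples are split into $K$ batches of $H$ samples each, with $T=KH$ and $K,H$ positive integers (the prescribed value of $K$ is assumed to be a positive integer dividing $T$). Starting from a deterministic initial parameter $x^{(0)}\in\mathbb{R}^d$, for $k=0,\dots,K-1$, $$g_k:=\frac1H\sum_{\ell=0}^{H-1}g(x^{(k)},\xi_{kH+\ell}),\qquad x^{(k+1)}=x^{(k)}-\alpha g_k .$$ $\log$ is the natural logarithm. ''Universal constant'' means an absolute constant, independent of $f$, $g$, $d$, $L$, $\mu$, $\sigma$, $T$, $K$, $H$, $\delta$, $x^{(0)}$. *)

(* Defs.v *)
From mathcomp Require Import all_boot all_order all_algebra.
From mathcomp Require Import all_classical all_reals all_analysis.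

Set Implicit Arguments.
Unset Strict Implicit.
Unset Printing Implicit Defensive.

Import Order.TTheory GRing.Theory Num.Theory.
Import numFieldNormedType.Exports.

Local Open Scope classical_set_scope.
Local Open Scope ring_scope.

(* Vectors of R^d are row vectors ['rV[R]_d].  The library norm [`|u|] on them is
   the sup norm; it is used only for the topology (differentiability and Borel
   sets).  The 2-norm is [norm2]. *)
Section Euclidean.
Context {R : realType} {d : nat}.

Definition dotp (u v : 'rV[R]_d) : R := \sum_(i < d) u 0 i * v 0 i.

Definition norm2 (u : 'rV[R]_d) : R := Num.sqrt (dotp u u).

(* Only meaningful together with [differentiable f x]. *)
Definition gradient (f : 'rV[R]_d -> R) (x : 'rV[R]_d) : 'rV[R]_d :=
  \row_(i < d) 'D_(delta_mx 0 i) f x.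

Definition smooth (L : R) (f : 'rV[R]_d -> R) : Prop :=
  forall x y, norm2 (gradient f x - gradient f y) <= L * norm2 (x - y).

Definition strongly_convex (mu : R) (f : 'rV[R]_d -> R) : Prop :=
  forall x y,
    f y >= f x + dotp (gradient f x) (y - x) + mu / 2 * norm2 (x - y) ^+ 2.

Definition minimizer (f : 'rV[R]_d -> R) (x : 'rV[R]_d) : Prop :=
  forall y, f x <= f y.

End Euclidean.

(* The measurable space 'rV[R]_d with its Borel sigma-algebra. *)
Definition borel_rV (R : realType) (d : nat) : measurableType _ :=
  g_sigma_algebraType (@open 'rV[R]_d).

(* Joint measurability is what makes g(X, xi) a random vector when X is random. *)
Definition jointly_measurable {R : realType} {d : nat} {dX : measure_display}
    {Xi : measurableType dX} (g : 'rV[R]_d -> Xi -> 'rV[R]_d) : Prop :=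
  measurable_fun [set: borel_rV R d * Xi]
    (fun p : borel_rV R d * Xi => g p.1 p.2 : borel_rV R d).

Section IID.
Context {R : realType} {dO dX : measure_display}.
Context {Omega : measurableType dO} {Xi : measurableType dX}.
Variable P : probability Omega R.
Local Open Scope ereal_scope.

(* The laws are compared on measurable sets only: a measure carries no
   information on the other ones. *)
Definition same_law (X Y : {RV P >-> Xi}) : Prop :=
  forall A : set Xi, measurable A -> distribution P X A = distribution P Y A.

Definition mutually_independent (T : nat) (X : nat -> {RV P >-> Xi}) : Prop :=
  forall (J : {set 'I_T}) (A : 'I_T -> set Xi),
    (forall i, measurable (A i)) ->
    P (\bigcap_(i in [set` J]) (X i @^-1` A i)) =
    \prod_(i in J) P (X i @^-1` A i).

(* Only X 0, ..., X (T - 1) are constrained. *)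
Definition iid_as (xi : {RV P >-> Xi}) (T : nat) (X : nat -> {RV P >-> Xi}) :
    Prop :=
  (forall i, (i < T)%N -> same_law (X i) xi) /\ mutually_independent T X.

End IID.

Section BatchedSGD.
Context {R : realType} {d : nat} {Xi : Type}.
Variables (g : 'rV[R]_d -> Xi -> 'rV[R]_d) (alpha : R) (H : nat).
Variables (x0 : 'rV[R]_d) (xi : nat -> Xi).

Definition batch_gradient (k : nat) (x : 'rV[R]_d) : 'rV[R]_d :=
  H%:R^-1 *: \sum_(0 <= l < H) g x (xi (k * H + l)%N).

(* The iterate x^(k) along the realization xi 0, xi 1, ... of the samples. *)
Fixpoint batched_sgd (k : nat) : 'rV[R]_d :=
  if k is k'.+1 then
    batched_sgd k' - alpha *: batch_gradient k' (batched_sgd k')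
  else x0.

End BatchedSGD.

(* Main.v *)
Require Import Defs.
From HB Require Import structures.
From mathcomp Require Import all_boot all_order all_algebra.
From mathcomp Require Import all_classical all_reals all_analysis.
From mathcomp Require Import measurable_realfun ring lra.

Set Implicit Arguments.
Unset Strict Implicit.
Unset Printing Implicit Defensive.

Import Order.TTheory GRing.Theory Num.Theory.
Import numFieldNormedType.Exports.

Local Open Scope classical_set_scope.
Local Open Scope ring_scope.

(** A gradient step of size 1 / (2 L) taken with an error e in the gradient
    satisfies
      r' <= (1 - mu / (2 L)) r + |e|^2 / (4 L)
    ([gradient_step_gap_le]).  This is algebra: strong convexity at the new point
    together with smoothness bounds f from above, and strong convexity at the old
    point gives the Polyak-Lojasiewicz inequality.  Unrolling over K steps, with
    all squared errors at most B, leaves (1 - mu / (2 L))^K r_0 + B / (2 mu)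
    ([batched_sgd_gap_le]); the prescribed K makes the first term at most r_0 / T
    ([batched_rate_le]).  It remains to show that, with probability at least
    1 - delta, all K batch errors satisfy |e_k|^2 <= 32 (sigma^2 / H) ln(2 K /
    delta).

    The batch error is 1 / H times a sum S_H of noise vectors, each centered given
    the past and with E exp(|X|^2 / sigma^2) <= e.  A coordinatewise bound would
    lose a factor d, so the squared norm itself is tracked: for such an X and a
    fixed s,
      E exp(b |s + X|^2) <= exp(b (1 + 16 b sigma^2) |s|^2 + b sigma^2)
    as long as 2 b sigma^2 <= 1 ([integral_expR_sqr_norm2_add_le]).  Its proof
    bounds exp(b |s + X|^2) pointwise by a combination of <s, X>, 1 and
    exp(|X|^2 / sigma^2), the quantities whose means are known
    ([expR_sqr_norm2_add_le]).  Along the batch the coefficients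
    b_l = 1 / (16 sigma^2 (H + l)) make exp(b_l |S_l|^2) a supermartingale up to
    the factors exp(b_l sigma^2), whose product is bounded
    ([noise_sum_exp_moment]); hence
    E exp(H |e_k|^2 / (32 sigma^2)) <= 2 ([batch_error_exp_moment]).  Markov's
    inequality for the sum of these exponentials over the batches concludes
    ([sum_expR_tail]).

    Conditioning on the past is done by [freezing]: the sigma-algebra generated by
    the first n samples is independent of sample n, so Tonelli's theorem allows
    integrating over that sample with the iterate and partial sum held fixed. *)

(** * Euclidean geometry of row vectors *)

Section EuclideanTheory.
Context {R : realType} {d : nat}.
Implicit Types (u v w : 'rV[R]_d) (a : R).

Lemma dotpC u v : dotp u v = dotp v u.
Proof. by apply: eq_bigr => i _; rewrite mulrC. Qed.

Lemma dotpDl u v w : dotp (u + v) w = dotp u w + dotp v w.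
Proof. by rewrite -big_split; apply: eq_bigr => i _; rewrite mxE mulrDl. Qed.

Lemma dotpZl a u v : dotp (a *: u) v = a * dotp u v.
Proof. by rewrite mulr_sumr; apply: eq_bigr => i _; rewrite mxE mulrA. Qed.

Lemma dotpDr u v w : dotp u (v + w) = dotp u v + dotp u w.
Proof. by rewrite !(dotpC u) dotpDl. Qed.

Lemma dotpZr a u v : dotp u (a *: v) = a * dotp u v.
Proof. by rewrite !(dotpC u) dotpZl. Qed.

Lemma dotpNl u v : dotp (- u) v = - dotp u v.
Proof. by rewrite -scaleN1r dotpZl mulN1r. Qed.

Lemma dotpNr u v : dotp u (- v) = - dotp u v.
Proof. by rewrite !(dotpC u) dotpNl. Qed.

Definition dotpE := (dotpDl, dotpDr, dotpNl, dotpNr, dotpZl, dotpZr).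

Lemma dotp_ge0 u : 0 <= dotp u u.
Proof. by apply: sumr_ge0 => i _; rewrite -expr2 sqr_ge0. Qed.

Lemma norm2_ge0 u : 0 <= norm2 u.
Proof. exact: sqrtr_ge0. Qed.

Lemma sqr_norm2 u : norm2 u ^+ 2 = dotp u u.
Proof. by rewrite sqr_sqrtr// dotp_ge0. Qed.

Lemma sqr_coord_le_dotp u i : u 0 i ^+ 2 <= dotp u u.
Proof.
rewrite /dotp (bigD1 i)//= -expr2 lerDl.
by apply: sumr_ge0 => j _; rewrite -expr2 sqr_ge0.
Qed.

(** Cauchy-Schwarz, from the nonnegativity of |<v, v> u - <u, v> v|^2. *)
Lemma sqr_dotp_le u v : dotp u v ^+ 2 <= dotp u u * dotp v v.
Proof.
have [v0|v0] := eqVneq (dotp v v) 0.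
  have v00 i : v 0 i = 0.
    have := sqr_coord_le_dotp v i; rewrite v0 => h.
    by apply/eqP; rewrite -sqrf_eq0 eq_le h sqr_ge0.
  by rewrite v0 mulr0 [dotp u v]big1 ?expr0n// => i _; rewrite v00 mulr0.
have vgt0 : 0 < dotp v v by rewrite lt_def v0 dotp_ge0.
have := dotp_ge0 (dotp v v *: u - dotp u v *: v).
rewrite !dotpE (dotpC v u).
set a := dotp u u; set b := dotp u v; set c := dotp v v in v0 vgt0 *.
rewrite [X in 0 <= X -> _](_ : _ = c * (a * c - b ^+ 2)); last by ring.
by rewrite pmulr_rge0// subr_ge0.
Qed.

Lemma dotp_le_norm2 u v : dotp u v <= norm2 u * norm2 v.
Proof.
rewrite /norm2 -sqrtrM ?dotp_ge0//.
rewrite (le_trans (ler_norm _))// -sqrtr_sqr ler_wsqrtr// sqr_dotp_le//.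
Qed.

End EuclideanTheory.

(** * Pointwise exponential inequalities *)

Section ExpBounds.
Context {R : realType}.
Implicit Types u t h Y z : R.

(** The linear term has mean zero when [u] is centered, which turns this into a
    quadratic bound on the logarithm of the moment generating function.  The
    factor 2 lets both regimes follow from 1 + u <= exp(u) alone: for u <= 1/2
    through exp(u) <= 1 / (1 - u) <= 1 + u + 2 u^2, and for larger [u] because
    u <= 2 u^2. *)
Lemma expR_le_add_expR_sqr u : expR u <= u + expR (2 * u ^+ 2).
Proof.
have [u2|u2] := leP u (1 / 2).
  have h : expR u * (1 - u) <= 1.
    have := expR_ge1Dx (- u); rewrite -[X in _ -> _ <= X](expRxMexpNx_1 u) => h.
    by rewrite ler_pM2l ?expR_gt0//; lra.
  have u1 : 0 < 1 - u by lra.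
  have : expR u <= 1 + u + 2 * u ^+ 2.
    rewrite -(ler_pM2r u1) (le_trans h)//.
    rewrite -subr_ge0 [X in 0 <= X](_ : _ = u ^+ 2 * (1 - 2 * u)); last by ring.
    by rewrite mulr_ge0 ?sqr_ge0//; lra.
  have := expR_ge1Dx (2 * u ^+ 2); lra.
have : expR u <= expR (2 * u ^+ 2) by rewrite ler_expR; nra.
lra.
Qed.

(** Convexity of exp between 0 and [z]: both ends lie above the tangent at
    [t * z]. *)
Lemma expR_chord_le t z : 0 <= t <= 1 -> expR (t * z) <= 1 - t + t * expR z.
Proof.
move=> /andP[t0 t1].
have h1 : expR (t * z) * (1 + (z - t * z)) <= expR z.
  by rewrite -[X in _ <= expR X](subrKC (t * z)) expRD ler_pM2l ?expR_gt0//;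
    exact: expR_ge1Dx.
have h0 : expR (t * z) * (1 - t * z) <= 1.
  rewrite -[X in _ <= X](expRxMexpNx_1 (t * z)) ler_pM2l ?expR_gt0//.
  exact: expR_ge1Dx.
set e := expR (t * z) in h1 h0 *; set E := expR z in h1 *.
have : t * (e * (1 + (z - t * z))) + (1 - t) * (e * (1 - t * z)) <=
  t * E + (1 - t) * 1.
  by apply: lerD; apply: ler_wpM2l => //; lra.
rewrite (_ : t * _ + _ = e); last by ring.
lra.
Qed.

(** A pointwise substitute for Jensen's inequality: if the mean of exp(Y) is at
    most [expR 1], integrating the right-hand side bounds the mean of exp(t Y)
    by exp(t). *)
Lemma expR_scale_le t Y : 0 <= t <= 1 ->
  expR (t * Y) <= expR t * (1 - t) + expR t * t / expR 1 * expR Y.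
Proof.
move=> t01; rewrite [t * Y](_ : _ = t + t * (Y - 1)); last by ring.
rewrite expRD.
have := expR_chord_le (Y - 1) t01; rewrite (expRD Y) expRN => h.
apply: le_trans (ler_wpM2l (expR_ge0 t) h) _.
by rewrite le_eqVlt; apply/orP; left; apply/eqP; ring.
Qed.

(** The coefficients do not depend on [u] and [Y], so the bound can be
    integrated: if [u] has mean zero and the mean of exp(Y) is at most [expR 1],
    the mean of exp(u) is at most [p + r * expR 1] = exp(2 h).  Thus a centered
    [u] dominated by sqrt(h Y) is sub-Gaussian with variance proxy of order [h].
    For 2 h <= 1 the bound comes from [expR_le_add_expR_sqr], and otherwise from
    u <= h / 2 + Y / 2. *)
Lemma expR_sub_gaussian h : 0 <= h ->
  exists a p r, [/\ 0 <= r, p + r * expR 1 = expR (2 * h) &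
    forall u Y, u ^+ 2 <= h * Y -> expR u <= a * u + p + r * expR Y].
Proof.
move=> h0.
have e1 : expR 1 != 0 :> R by rewrite gt_eqF ?expR_gt0.
have [h1|h1] := leP (2 * h) 1.
  exists 1, (expR (2 * h) * (1 - 2 * h)),
    (expR (2 * h) * (2 * h) / expR 1).
  split; first by rewrite !mulr_ge0 ?invr_ge0 ?expR_ge0.
    by rewrite divfK//; ring.
  move=> u Y uY; rewrite mul1r -addrA (le_trans (expR_le_add_expR_sqr u))//.
  rewrite lerD2l; apply: le_trans (expR_scale_le Y _); last by rewrite mulr_ge0.
  by rewrite ler_expR -mulrA ler_pM2l.
exists 0, (expR (2 * h) * (1 - 2^-1)), (expR (2 * h) * 2^-1 / expR 1).
split; first by rewrite !mulr_ge0 ?invr_ge0 ?expR_ge0.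
  by rewrite divfK//; field.
move=> u Y uY; rewrite mul0r add0r.
have Y0 : 0 <= Y.
  by rewrite -(@pmulr_rge0 _ h) ?(le_trans (sqr_ge0 u))//; lra.
have uhY : u <= h / 2 + 2^-1 * Y.
  rewrite (le_trans (ler_norm _))//.
  have hY0 : 0 <= h / 2 + 2^-1 * Y by lra.
  rewrite -(@ler_pXn2r _ 2)// ?nnegrE// ?real_normK ?num_real//.
  rewrite (le_trans uY)// -subr_ge0.
  rewrite [X in 0 <= X](_ : _ = (h / 2 - 2^-1 * Y) ^+ 2); last by field.
  exact: sqr_ge0.
have half01 : 0 <= (2^-1 : R) <= 1 by lra.
have := expR_scale_le Y half01.
set A := (X in _ <= X) => hA.
have -> : expR (2 * h) * (1 - 2^-1) +
    expR (2 * h) * 2^-1 / expR 1 * expR Y = expR (2 * h - 2^-1) * A.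
  by rewrite -[2 * h in LHS](subrK 2^-1) expRD /A; ring.
rewrite (le_trans (y := expR (h / 2) * expR (2^-1 * Y)))//.
  by rewrite -expRD ler_expR.
rewrite ler_pM ?expR_ge0// ler_expR; lra.
Qed.

End ExpBounds.

Section OneStep.
Context {R : realType} {d : nat}.
Implicit Types (s X : 'rV[R]_d).

(** The heart of the dimension-free concentration bound.  Expanding
    |s + X|^2 = |s|^2 + 2 <s, X> + |X|^2, the cross term is controlled by
    [expR_sub_gaussian] with h = 16 b^2 |s|^2 v, the square by [expR_scale_le],
    and the two are separated by the arithmetic-geometric mean inequality.  Once
    integrated over a centered [X] with mean of exp(|X|^2 / v) at most [expR 1],
    the bound says that adding [X] to [s] costs a factor exp(b v) and an increase
    of [b] to b (1 + 16 b v), with no dependence on the dimension. *)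
Lemma expR_sqr_norm2_add_le (v b : R) s :
  0 < v -> 0 <= b -> 2 * b * v <= 1 ->
  exists a p r, [/\ 0 <= r,
    p + r * expR 1 = expR (b * (1 + 16 * b * v) * norm2 s ^+ 2 + b * v) &
    forall X, expR (b * norm2 (s + X) ^+ 2) <=
      a * dotp s X + p + r * expR (norm2 X ^+ 2 / v)].
Proof.
move=> v0 b0 bv1; set n := norm2 s ^+ 2.
have n0 : 0 <= n by exact: sqr_ge0.
pose h := 16 * b ^+ 2 * n * v.
have v0' := ltW v0.
have h0 : 0 <= h by rewrite !mulr_ge0 ?sqr_ge0 ?norm2_ge0.
have [a [p [r [r0 pr hu]]]] := expR_sub_gaussian h0.
have e1 : expR 1 != 0 :> R by rewrite gt_eqF ?expR_gt0.
pose c := expR (b * n) / 2.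
pose k1 := c * expR (b * v - h); pose k2 := c * expR (h - b * v).
have c0 : 0 <= c by rewrite divr_ge0// expR_ge0.
have k10 : 0 <= k1 by rewrite mulr_ge0 ?expR_ge0.
have k20 : 0 <= k2 by rewrite mulr_ge0 ?expR_ge0.
pose t := 2 * b * v; have t01 : 0 <= t <= 1 by rewrite bv1 !mulr_ge0.
exists (k1 * (a * (4 * b))), (k1 * p + k2 * (expR t * (1 - t))),
  (k1 * r + k2 * (expR t * t / expR 1)).
split.
- by rewrite addr_ge0// !mulr_ge0// ?invr_ge0 ?expR_ge0//; case/andP: t01.
- rewrite [LHS](_ : _ = k1 * (p + r * expR 1) + k2 * expR t);
    last by field.
  rewrite pr /k1 /k2 -!(mulrA c) -!expRD.
  rewrite [b * v - h + 2 * h](_ : _ = h + b * v); last by ring.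
  rewrite [h - b * v + t](_ : _ = h + b * v); last by rewrite /t; ring.
  rewrite -mulrDl -splitr -expRD.
  by congr expR; rewrite /h; ring.
move=> X; set Y := norm2 X ^+ 2 / v.
have hq : (4 * b * dotp s X) ^+ 2 <= h * Y.
  rewrite /h /Y [leRHS](_ : _ = 16 * b ^+ 2 * (n * norm2 X ^+ 2)); last first.
    by field; rewrite gt_eqF.
  rewrite exprMn [leLHS](_ : _ = 16 * b ^+ 2 * (dotp s X ^+ 2)); last by ring.
  by rewrite ler_wpM2l ?mulr_ge0 ?sqr_ge0// /n !sqr_norm2 sqr_dotp_le.
have {hu}hu := hu _ _ hq.
have ht := expR_scale_le Y t01.
have -> : b * norm2 (s + X) ^+ 2 =
    b * n + (2 * b * dotp s X + b * norm2 X ^+ 2).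
  by rewrite /n !sqr_norm2 !dotpE (dotpC X s); ring.
set A := 2 * b * dotp s X; set B := b * norm2 X ^+ 2.
(* weighted arithmetic-geometric mean inequality; the weights balance the two
   bounds exp(2 h) and exp(t) = exp(2 b v) on the means of the two factors *)
have amgm : expR (b * n + (A + B)) <=
    k1 * expR (4 * b * dotp s X) + k2 * expR (t * Y).
  pose x := A + (b * v - h) / 2; pose y := B - (b * v - h) / 2.
  rewrite (_ : k1 * _ = c * expR x ^+ 2); last first.
    rewrite -expRM_natl -(mulrA c) -expRD; congr (_ * expR _).
    by rewrite /x /A; field.
  rewrite (_ : k2 * _ = c * expR y ^+ 2); last first.
    rewrite -expRM_natl -(mulrA c) -expRD; congr (_ * expR _).
    by rewrite /y /B /t /Y; field; rewrite gt_eqF.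
  rewrite expRD (_ : A + B = x + y); last by rewrite /x /y; ring.
  rewrite expRD /c -mulrDr -mulrA ler_pM2l ?expR_gt0//.
  by have := sqr_ge0 (expR x - expR y); nra.
apply: (le_trans amgm).
have := ler_wpM2l k10 hu; have := ler_wpM2l k20 ht.
lra.
Qed.

End OneStep.

(** * Perturbed gradient descent for smooth strongly convex functions *)

Section Descent.
Context {R : realType} {d : nat} (f : 'rV[R]_d -> R) (L mu : R).
Hypotheses (smf : smooth L f) (mu0 : 0 < mu) (scf : strongly_convex mu f).

(** Convexity compares [f y] with the tangent at [y], and smoothness moves the
    gradient from [y] to [x].  The constant is [L] instead of the usual L / 2, but
    no integration along the segment is involved, and step size 1 / (2 L) still
    yields the contraction factor 1 - mu / (2 L). *)
Lemma smooth_convex_upper_bound x y :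
  f y <= f x + dotp (gradient f x) (y - x) + L * norm2 (y - x) ^+ 2.
Proof.
have h1 := scf y x.
have h2 : dotp (gradient f y - gradient f x) (y - x) <= L * norm2 (y - x) ^+ 2.
  rewrite (le_trans (dotp_le_norm2 _ _))// expr2 mulrA.
  by rewrite ler_wpM2r ?norm2_ge0.
have h3 : 0 <= mu / 2 * norm2 (y - x) ^+ 2.
  by rewrite mulr_ge0 ?sqr_ge0// divr_ge0// ltW.
move: h1 h2; rewrite -opprB !dotpE => h1 h2; lra.
Qed.

(** The Polyak-Lojasiewicz inequality: minimize the quadratic lower bound at [x],
    that is, use |gradient + mu (z - x)|^2 >= 0. *)
Lemma strongly_convex_gap_le x z :
  2 * mu * (f x - f z) <= norm2 (gradient f x) ^+ 2.
Proof.
have h1 := scf x z.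
have := sqr_ge0 (norm2 (gradient f x + mu *: (z - x))).
rewrite !sqr_norm2 !dotpE (dotpC z (gradient f x)) (dotpC x (gradient f x)).
rewrite (dotpC x z).
move: h1; rewrite !sqr_norm2 !dotpE.
rewrite (dotpC x z) => h1 h2.
have mu2 : 0 <= 2 * mu by rewrite mulr_ge0 ?ltW.
have := ler_wpM2l mu2 h1; lra.
Qed.

Lemma strongly_convex_le_smooth : (0 < d)%N -> mu <= L.
Proof.
move=> d0; pose u : 'rV[R]_d := const_mx 1.
have nu : norm2 u ^+ 2 = d%:R.
  rewrite sqr_norm2 /dotp (eq_bigr (fun=> 1)) ?sumr_const ?card_ord//.
  by move=> i _; rewrite !mxE mulr1.
have nu0 : 0 < norm2 u ^+ 2 by rewrite nu ltr0n.
have h1 := scf u 0; have h2 := scf 0 u.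
rewrite subr0 sub0r in h1; rewrite subr0 sub0r in h2.
have h3 : dotp (gradient f u - gradient f 0) u <= L * norm2 u ^+ 2.
  rewrite (le_trans (dotp_le_norm2 _ _))// expr2 mulrA.
  by have := smf u 0; rewrite subr0 => h; rewrite ler_wpM2r ?norm2_ge0.
rewrite -(ler_pM2r nu0).
move: h1 h2 h3 nu0; rewrite !sqr_norm2 !dotpE; lra.
Qed.

(** For this step size the cross terms between the gradient and its error cancel
    in the expansion of [smooth_convex_upper_bound], so the error enters only
    through its square; the remaining decrease is proportional to the squared
    gradient, to which [strongly_convex_gap_le] applies. *)
Lemma gradient_step_gap_le x e z : 0 < L ->
  f (x - (1 / (2 * L)) *: (gradient f x + e)) - f z <=
  (1 - mu / (2 * L)) * (f x - f z) + norm2 e ^+ 2 / (4 * L).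
Proof.
move=> L0.
set G := gradient f x.
have h1 := smooth_convex_upper_bound x (x - (1 / (2 * L)) *: (G + e)).
have h2 := strongly_convex_gap_le x z.
have h3 : dotp G (- ((1 / (2 * L)) *: (G + e))) +
    L * norm2 (- ((1 / (2 * L)) *: (G + e))) ^+ 2 =
    norm2 e ^+ 2 / (4 * L) - norm2 G ^+ 2 / (4 * L).
  by rewrite !sqr_norm2 !dotpE (dotpC e G); field; rewrite gt_eqF.
have h4 : x - (1 / (2 * L)) *: (G + e) - x = - ((1 / (2 * L)) *: (G + e)).
  by rewrite [LHS]addrC addrA addNr add0r.
rewrite h4 -/G -addrA h3 in h1.
have : mu / (2 * L) * (f x - f z) <= norm2 G ^+ 2 / (4 * L).
  rewrite [leLHS](_ : _ = 2 * mu * (f x - f z) / (4 * L)); last first.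
    by field; rewrite gt_eqF.
  by rewrite ler_pM2r// invr_gt0 mulr_gt0.
lra.
Qed.

Lemma batched_sgd_gap_le (Xi : Type) (g : 'rV[R]_d -> Xi -> 'rV[R]_d)
    (H K : nat) (x0 z : 'rV[R]_d) (xi : nat -> Xi) (B : R) :
  let x := batched_sgd g (1 / (2 * L)) H x0 xi in
  0 < L -> mu <= L -> 0 <= B ->
  (forall k, (k < K)%N ->
    norm2 (batch_gradient g H xi k (x k) - gradient f (x k)) ^+ 2 <= B) ->
  f (x K) - f z <= (1 - mu / (2 * L)) ^+ K * (f x0 - f z) + B / (2 * mu).
Proof.
move=> x L0 muL B0; elim: K => [|K IH] hB.
  by rewrite expr0 mul1r lerDl divr_ge0// mulr_ge0// ltW.
have {}IH := IH (fun k kK => hB k (ltnW kK)).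
have := gradient_step_gap_le (x K)
  (batch_gradient g H xi K (x K) - gradient f (x K)) z L0.
rewrite subrKC => h1; apply: (le_trans h1).
have q0 : 0 <= 1 - mu / (2 * L).
  by rewrite subr_ge0 ler_pdivrMr ?mulr_gt0// mul1r; lra.
have := ler_wpM2l q0 IH.
have : norm2 (batch_gradient g H xi K (x K) - gradient f (x K)) ^+ 2 / (4 * L)
    <= B / (4 * L).
  by rewrite ler_pM2r ?invr_gt0 ?mulr_gt0// hB.
have -> : (1 - mu / (2 * L)) ^+ K.+1 * (f x0 - f z) + B / (2 * mu) =
   (1 - mu / (2 * L)) * ((1 - mu / (2 * L)) ^+ K * (f x0 - f z) +
      B / (2 * mu)) + B / (4 * L).
  by rewrite exprS; field; rewrite !gt_eqF.
lra.
Qed.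

End Descent.

(** * Borel measurability of vector-valued maps *)

Section BorelVectors.
Context {R : realType} {d : nat}.

(** Every open set is the union of the rational boxes that it contains, and there
    are countably many of them. *)
Lemma measurable_borel_rV {dT} {T : measurableType dT} (h : T -> 'rV[R]_d) :
  (forall i, measurable_fun [set: T] (fun t => h t 0 i)) ->
  measurable_fun [set: T] (h : T -> borel_rV R d).
Proof.
move=> mh.
apply: (@measurability _ _ T (borel_rV R d) _ _ (@open 'rV[R]_d)) => //.
move=> _ [U oU <-]; rewrite setTI.
pose box (p : 'rV[rat]_d * nat) : set 'rV[R]_d :=
  [set x | forall i, `|ratr (p.1 0 i) - x 0 i| < p.2.+1%:R^-1].
have mbox p : measurable (h @^-1` box p).
  rewrite [X in measurable X](_ : _ = \bigcap_(i in [set: 'I_d])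
      (fun t => h t 0 i) @^-1` ball (ratr (p.1 0 i) : R) p.2.+1%:R^-1);
    last first.
    by apply/seteqP; split => [t ht i _|t ht i]; [exact: ht|exact: ht].
  apply: fin_bigcap_measurable => // i _.
  rewrite -[X in measurable X]setTI; apply: mh => //.
  apply: open_measurable; exact: ball_open.
rewrite [X in measurable X](_ : _ =
   \bigcup_p (if pselect (box p `<=` U) then h @^-1` box p else set0));
  last first.
  apply/seteqP; split => [t Ut|t [p _]]; last first.
    by case: pselect => // pU /pU.
  have /nbhs_ballP[e /= e0 eU] : nbhs (h t) U by exact: open_nbhs_nbhs.
  have [n ne] : exists n, n.+1%:R^-1 < e / 2.
    have e20 : 0 < e / 2 by rewrite divr_gt0.
    have [n _ /(_ n (leqnn n)) hn] := near_infty_natSinv_lt (PosNum e20).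
    by exists n.
  have hq i : exists q : rat, `|ratr q - h t 0 i| < n.+1%:R^-1.
    have [|q] := @rat_in_itvoo R (h t 0 i - n.+1%:R^-1) (h t 0 i + n.+1%:R^-1).
      by rewrite ltrD2l gt0_cp.
    rewrite in_itv/= => /andP[q1 q2]; exists q.
    by rewrite ltr_norml ltrBrDl q1 ltrBlDl q2.
  have [q qP] := choice hq.
  exists (\row_i q i, n) => //.
  case: pselect => [_ i|[]] /=; first by rewrite mxE.
  move=> x xbox; apply: eU; split => // i j; rewrite (ord1 i).
  have := xbox j; rewrite /= mxE => h1; have := qP j => h2.
  rewrite /ball/= (_ : _ - _ = (h t 0 j - ratr (q j)) + (ratr (q j) - x 0 j));
    last by ring.
  rewrite (le_lt_trans (ler_normD _ _))// distrC (splitr e).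
  by rewrite ltrD // (lt_trans _ ne).
apply: countable_bigcupT_measurable => [|p]; first exact: countableP.
by case: pselect => pU; [exact: mbox|exact: measurable0].
Qed.

Lemma continuous_measurable_rV (f : 'rV[R]_d -> R) :
  continuous f -> measurable_fun [set: borel_rV R d] (f : borel_rV R d -> R).
Proof.
move=> /continuousP cf.
apply: (measurability _ (RGenOInfty.measurableE R)) => _ [_ [a ->]] <-.
rewrite setTI; apply: sub_sigma_algebra; apply: cf.
exact: interval_open.
Qed.

Lemma measurable_coord {dT} {T : measurableType dT} (h : T -> borel_rV R d) i :
  measurable_fun [set: T] h ->
  measurable_fun [set: T] (fun t => (h t : 'rV[R]_d) 0 i).
Proof.
move=> mh; pose cont := continuous_measurable_rV (@coord_continuous _ _ _ 0 i).
exact: (measurableT_comp cont mh).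
Qed.

End BorelVectors.

Section BorelVectorOperations.
Context {R : realType} {d : nat} {dT : measure_display} {T : measurableType dT}.
Implicit Types h : T -> borel_rV R d.

Lemma measurable_rV_add h1 h2 :
  measurable_fun [set: T] h1 -> measurable_fun [set: T] h2 ->
  measurable_fun [set: T]
    (fun t => ((h1 t : 'rV[R]_d) + h2 t : 'rV[R]_d) : borel_rV R d).
Proof.
move=> m1 m2; apply: measurable_borel_rV => i; under eq_fun do rewrite mxE.
by apply: measurable_funD; exact: measurable_coord.
Qed.

Lemma measurable_rV_scale a h : measurable_fun [set: T] h ->
  measurable_fun [set: T] (fun t => (a *: (h t : 'rV[R]_d)) : borel_rV R d).
Proof.
move=> mh; apply: measurable_borel_rV => i; under eq_fun do rewrite mxE.
by apply: measurable_funM => //; exact: measurable_coord.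
Qed.

Lemma measurable_rV_sub h1 h2 :
  measurable_fun [set: T] h1 -> measurable_fun [set: T] h2 ->
  measurable_fun [set: T]
    (fun t => ((h1 t : 'rV[R]_d) - h2 t : 'rV[R]_d) : borel_rV R d).
Proof.
move=> m1 m2; under eq_fun do rewrite -scaleN1r.
by apply: measurable_rV_add => //; exact: measurable_rV_scale.
Qed.

Lemma measurable_rV_sum n (h : nat -> T -> borel_rV R d) :
  (forall j, (j < n)%N -> measurable_fun [set: T] (h j)) ->
  measurable_fun [set: T]
    (fun t => (\sum_(0 <= j < n) (h j t : 'rV[R]_d)) : borel_rV R d).
Proof.
elim: n => [|n IH] mh.
  by under eq_fun do rewrite big_geq//; exact: measurable_cst.
under eq_fun do rewrite big_nat_recr//=.
apply: measurable_rV_add; last exact: mh.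
by apply: IH => j jn; apply: mh; rewrite ltnW.
Qed.

Lemma measurable_sqr_norm2 h :
  measurable_fun [set: T] h ->
  measurable_fun [set: T] (fun t => norm2 (h t : 'rV[R]_d) ^+ 2)%R.
Proof.
move=> mh; under eq_fun do rewrite sqr_norm2.
by apply: measurable_sum => i; apply: measurable_funM; exact: measurable_coord.
Qed.

Lemma measurable_expR_sqr_norm2 h (b : R) :
  measurable_fun [set: T] h ->
  measurable_fun [set: T]
    (fun t => (expR (b * norm2 (h t : 'rV[R]_d) ^+ 2))%:E).
Proof.
move=> mh; apply/measurable_EFinP; apply: measurableT_comp => //.
by apply: measurable_funM => //; exact: measurable_sqr_norm2.
Qed.

End BorelVectorOperations.

Section SmoothGradient.
Context {R : realType} {d : nat}.

(** Smoothness is a Lipschitz bound for the 2-norm, while continuity refers to the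
    sup norm; they differ by a factor at most [d]. *)
Lemma smooth_gradient_coord_continuous (f : 'rV[R]_d -> R) L i :
  smooth L f -> continuous (fun x => gradient f x 0 i).
Proof.
move=> sm x; apply/(@cvgrPdist_lt _ _ _ (nbhs x)) => e e0.
pose C := `|L| * d%:R + 1.
have C0 : 0 < C by rewrite ltr_wpDl// mulr_ge0.
apply/nbhs_ballP; exists (e / C) => /=; first exact: divr_gt0.
move=> y [_ xy].
have eC0 : 0 <= e / C by apply/ltW; exact: divr_gt0.
have nxy : norm2 (x - y) <= d%:R * (e / C).
  rewrite -(ler_pXn2r (n := 2))// ?nnegrE ?norm2_ge0 ?(mulr_ge0 _ eC0)//.
  rewrite sqr_norm2; apply: (@le_trans _ _ (\sum_(j < d) (e / C) ^+ 2)).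
    apply: ler_sum => j _; have := xy 0 j; rewrite /ball/= => /ltW h.
    by rewrite -expr2 !mxE -[leLHS]real_normK ?num_real// lerXn2r.
  rewrite sumr_const card_ord -[leLHS]mulr_natl [leRHS]exprMn.
  rewrite ler_wpM2r ?sqr_ge0// -natrX ler_nat.
  by case: (d) => // k; rewrite leq_pmulr.
have : `|gradient f x 0 i - gradient f y 0 i| <=
    norm2 (gradient f x - gradient f y).
  rewrite -(ler_pXn2r (n := 2))// ?nnegrE ?norm2_ge0// real_normK ?num_real//.
  rewrite sqr_norm2; apply: le_trans (sqr_coord_le_dotp _ i).
  by rewrite !mxE.
move=> h; apply: (le_lt_trans h); apply: (le_lt_trans (sm x y)).
have h1 : L * norm2 (x - y) <= `|L| * (d%:R * (e / C)).
  apply: (le_trans (ler_norm _)); rewrite normrM (ger0_norm (norm2_ge0 _)).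
  by rewrite ler_wpM2l.
apply: (le_lt_trans h1).
rewrite [ltLHS](_ : _ = (C - 1) / C * e); last first.
  by rewrite /C; field; rewrite gt_eqF.
by rewrite gtr_pMl// ltr_pdivrMr// mul1r ltrBlDr ltrDl.
Qed.

End SmoothGradient.

(** * Independence of a sample from the past *)

Section Freezing.
Context {R : realType} {dO dX : measure_display}.
Context {Omega : measurableType dO} {Xi : measurableType dX}.
Variables (P : probability Omega R) (X : nat -> {RV P >-> Xi}).

(** Rectangular events about the first [n] samples.  They form a pi-system
    generating the sigma-algebra of the past, on which mutual independence can be
    applied directly. *)
Definition past_cylinders (n : nat) : set_system Omega :=
  [set E | exists2 A : nat -> set Xi, forall i, measurable (A i) &
     E = \bigcap_(i in `I_n) X i @^-1` A i].

Notation past n := (g_sigma_algebraType (past_cylinders n)).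

Lemma past_cylinders_measurable n E : past_cylinders n E -> measurable E.
Proof.
case=> A mA ->; apply: bigcap_measurableType => i _.
by rewrite -[X in measurable X]setTI; exact: measurable_funP.
Qed.

Lemma past_cylindersT n : past_cylinders n setT.
Proof.
exists (fun=> setT) => [i|]; first exact: measurableT.
by apply/seteqP; split.
Qed.

Lemma past_cylindersI n : setI_closed (past_cylinders n).
Proof.
move=> _ _ [A mA ->] [B mB ->]; exists (fun i => A i `&` B i).
  by move=> i; exact: measurableI.
by rewrite -bigcapI.
Qed.

Local Open Scope ereal_scope.

(** The family fed to mutual independence consists of the sides of the rectangle
    and of [B] at index [n]. *)
Lemma past_cylinders_independent T n E (B : set Xi) : (n < T)%N ->
  mutually_independent T X -> past_cylinders n E -> measurable B ->
  P (E `&` X n @^-1` B) = P E * P (X n @^-1` B).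
Proof.
move=> nT indX [A mA ->] mB.
pose A' (i : 'I_T) := if (i < n)%N then A i else B.
have mA' i : measurable (A' i) by rewrite /A'; case: ifP.
pose J := [set i : 'I_T | (i < n)%N]%SET.
pose n' := Ordinal nT.
have n'J : n' \notin J by rewrite inE/= ltnn.
have bigJ : \bigcap_(i in `I_n) X i @^-1` A i =
    \bigcap_(i in [set` J]) X i @^-1` A' i.
  apply/seteqP; split=> w Aw i /= ni.
    by move: (ni); rewrite inE /A' => ni'; rewrite /preimage/= ni'; exact: Aw.
  have := Aw (Ordinal (ltn_trans ni nT)); rewrite /preimage/= /A'/= ni.
  by apply; rewrite inE.
have bigJn : (\bigcap_(i in `I_n) X i @^-1` A i) `&` X n @^-1` B =
    \bigcap_(i in [set` (n' |: J)%SET]) X i @^-1` A' i.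
  rewrite bigJ; apply/seteqP; split => [w [Aw Bw] i /= | w Aw].
    rewrite in_setU1 => /orP[/eqP->|iJ]; last exact: Aw.
    by rewrite /preimage/= /A'/= ltnn.
  split=> [i iJ|]; first by apply: Aw; rewrite /= in_setU1; apply/orP; right.
  have := Aw n'; rewrite /preimage/= /A'/= ltnn; apply.
  by rewrite in_setU1 eqxx.
rewrite bigJn bigJ !indX// big_setU1//= muleC /A' /=.
by rewrite ltnn.
Qed.

(** Intersecting with the event on sample [n], and scaling by its probability,
    define two finite measures that agree on a generating pi-system. *)
Lemma past_independent T n (E : set Omega) (B : set Xi) : (n < T)%N ->
  mutually_independent T X -> <<s past_cylinders n >> E -> measurable B ->
  P (E `&` X n @^-1` B) = P E * P (X n @^-1` B).
Proof.
move=> nT indX pE mB.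
have mD : measurable (X n @^-1` B).
  by rewrite -[Y in measurable Y]setTI; exact: measurable_funP.
have PD0 : (0 <= fine (P (X n @^-1` B)))%R by rewrite fine_ge0.
pose m1 := mrestr P mD; pose m2 := mscale (NngNum PD0) P.
have PDE : P (X n @^-1` B) = (fine (P (X n @^-1` B)))%:E.
  by rewrite fineK// fin_num_measure.
have m1T (k : nat) : m1 setT < +oo by rewrite /m1 /mrestr setTI PDE ltry.
have m2E F : m2 F = P F * P (X n @^-1` B) by rewrite /m2 /mscale/= -PDE muleC.
rewrite -m2E.
apply: (@g_sigma_algebra_measure_unique _ _ _ (past_cylinders n) _
  (fun=> setT) _ _ m1 m2 _ _ m1T) => //.
- exact: past_cylinders_measurable.
- by move=> _; exact: past_cylindersT.
- by apply/seteqP; split => // w _; exists 0%N.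
- exact: past_cylindersI.
- move=> F pF; apply: etrans (esym (m2E F)).
  exact: (past_cylinders_independent nT).
Qed.

Lemma measurable_past_sub {dS} {S : measurableType dS} n (Z : Omega -> S) :
  measurable_fun [set: past n] (Z : past n -> S) ->
  measurable_fun [set: Omega] Z.
Proof.
move=> mZ _ B mB; have := mZ measurableT B mB.
apply: smallest_sub; first exact: sigma_algebra_measurable.
exact: past_cylinders_measurable.
Qed.

(** Given the past, sample [n] can be integrated out as a fresh copy of [xi] with
    the past frozen: by independence the joint law of [(Z, X n)] is a product
    measure, to which Tonelli applies.  This plays the role of conditional
    expectation. *)
Lemma freezing {dS} {S : measurableType dS} T n (xi : {RV P >-> Xi})
    (Z : Omega -> S) (phi : S * Xi -> \bar R) :
  (n < T)%N -> iid_as xi T X ->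
  measurable_fun [set: past n] (Z : past n -> S) ->
  measurable_fun [set: S * Xi] phi -> (forall z, 0 <= phi z) ->
  \int[P]_w phi (Z w, X n w) = \int[P]_w \int[P]_v phi (Z w, xi v).
Proof.
move=> nT [lawX indX] mZp mphi phi0.
have mZ := measurable_past_sub mZp.
have mZX : measurable_fun setT (fun w => (Z w, X n w)).
  by apply/measurable_fun_pairP; split => //=; exact: measurable_funP.
pose Y : {mfun Omega >-> S} := HB.pack_for {mfun Omega >-> S} Z
  (isMeasurableFun.Build _ _ _ _ Z mZ).
pose m1 := distribution P Y; pose m2 := distribution P xi.
pose m := pushforward P (fun w => (Z w, X n w)).
have lawE A : measurable A -> (m1 \x m2) A = m A.
  move=> mA.
  apply: (@product_measure_unique _ _ _ _ _ m1 m2 m) => // B C mB mC.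
  transitivity (P (Z @^-1` B `&` X n @^-1` C)) => //.
  rewrite (past_independent nT indX)//; last first.
    by rewrite -[E in <<s _>> E]setTI; exact: mZp.
  by congr (_ * _); exact: lawX.
transitivity (\int[m]_z phi z).
  by rewrite ge0_integral_pushforward//= preimage_setT.
transitivity (\int[m1 \x m2]_z phi z).
  by apply: eq_measure_integral => A mA _; apply/esym; exact: lawE.
rewrite fubini_tonelli1//.
rewrite ge0_integral_pushforward//=; last 2 first.
- exact: measurable_fun_fubini_tonelli_F.
- by move=> z _; apply: integral_ge0.
rewrite preimage_setT; apply: eq_integral => w _ /=.
rewrite /fubini_F ge0_integral_pushforward//=; last exact: measurableT_comp.
Qed.

End Freezing.

Notation past X n := (g_sigma_algebraType (past_cylinders X n)).

Section Filtration.
Context {R : realType} {dO dX : measure_display}.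
Context {Omega : measurableType dO} {Xi : measurableType dX}.
Variables (P : probability Omega R) (X : nat -> {RV P >-> Xi}).

Lemma measurable_past_le {dS} {S : measurableType dS} m n (Z : Omega -> S) :
  (m <= n)%N -> measurable_fun [set: past X m] (Z : past X m -> S) ->
  measurable_fun [set: past X n] (Z : past X n -> S).
Proof.
move=> mn mZ _ B mB; have := mZ measurableT B mB.
apply: smallest_sub; first exact: smallest_sigma_algebra.
move=> _ [A mA ->]; apply: sub_sigma_algebra.
exists (fun i => if (i < m)%N then A i else setT) => [i|]; first by case: ifP.
apply/seteqP; split => w Aw i /= im; last first.
  by have := Aw i (leq_trans im mn); rewrite /preimage/= im.
by rewrite /preimage/=; case: ifP => // im'; exact: Aw.
Qed.

Lemma measurable_past_sample m n : (m < n)%N ->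
  measurable_fun [set: past X n] (X m : past X n -> Xi).
Proof.
move=> mn _ B mB; rewrite setTI; apply: sub_sigma_algebra.
exists (fun i => if i == m then B else setT) => [i|]; first by case: ifP.
apply/seteqP; split => w.
  by move=> Bw i /= _; rewrite /preimage/=; case: ifP => // /eqP ->.
by move=> /(_ m mn); rewrite /preimage/= eqxx.
Qed.

End Filtration.

(** * Concentration of the batch noise *)

Section SubGaussianStep.
Context {R : realType} {d : nat} {dO : measure_display}.
Context {Omega : measurableType dO} (P : probability Omega R).
Local Open Scope ereal_scope.

Variables (V : Omega -> borel_rV R d) (v : R).
Hypotheses (mV : measurable_fun [set: Omega] V) (v0 : (0 < v)%R).
Hypothesis sgV :
  \int[P]_w (expR (norm2 (V w : 'rV[R]_d) ^+ 2 / v))%:E <= (expR 1)%:E.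

Lemma norm_sub_gaussian_integrable :
  P.-integrable [set: Omega]
    (fun w => (expR (norm2 (V w : 'rV[R]_d) ^+ 2 / v))%:E).
Proof.
apply/integrableP; split.
  under eq_fun do rewrite mulrC; exact: measurable_expR_sqr_norm2.
under eq_integral do rewrite gee0_abs ?lee_fin ?expR_ge0//.
by rewrite (le_lt_trans sgV)// ltry.
Qed.

(** A coordinate is dominated by 1 + |V|^2, hence by 1 + v exp(|V|^2 / v). *)
Lemma norm_sub_gaussian_coord_integrable i :
  P.-integrable [set: Omega] (fun w => ((V w : 'rV[R]_d) 0%R i)%:E).
Proof.
pose Q w : \bar R := (expR (norm2 (V w : 'rV[R]_d) ^+ 2 / v))%:E.
have int1 : P.-integrable [set: Omega] (fun w => 1 + v%:E * Q w).
  apply: integrableD => //; first exact: finite_measure_integrable_cst.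
  exact: integrableZl norm_sub_gaussian_integrable.
apply: (le_integrable measurableT _ _ int1).
  by apply/measurable_EFinP; exact: measurable_coord.
move=> w _ /=; rewrite lee_fin.
set u : 'rV_d := V w; set Y := (norm2 u ^+ 2 / v)%R.
have hY : (norm2 u ^+ 2 = v * Y)%R by rewrite /Y mulrC divfK// gt_eqF.
have : (u 0 i ^+ 2 <= v * expR Y)%R.
  rewrite (le_trans (sqr_coord_le_dotp u i))// -sqr_norm2 hY ler_pM2l//.
  by have := expR_ge1Dx Y; lra.
move=> h.
rewrite [X in (_ <= X)%R]ger0_norm ?addr_ge0 ?mulr_ge0 ?expR_ge0 ?ltW//.
rewrite -[(u 0 i ^+ 2)%R]real_normK ?num_real// in h.
by have := sqr_ge0 (`|u 0 i| - 1)%R; have := normr_ge0 (u 0%R i); nra.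
Qed.

(** [expR_sqr_norm2_add_le] integrated: its linear term vanishes because [V] is
    centered. *)
Lemma integral_expR_sqr_norm2_add_le (s : 'rV[R]_d) (b : R) :
  (forall i, \int[P]_w ((V w : 'rV[R]_d) 0%R i)%:E = 0) ->
  (0 <= b)%R -> (2 * b * v <= 1)%R ->
  \int[P]_w (expR (b * norm2 (s + V w) ^+ 2))%:E <=
  (expR (b * (1 + 16 * b * v) * norm2 s ^+ 2 + b * v))%:E.
Proof.
move=> cV b0 bv1.
have [a [p [r [r0 <- hpt]]]] := expR_sqr_norm2_add_le s v0 b0 bv1.
pose Q w : \bar R := (expR (norm2 (V w : 'rV[R]_d) ^+ 2 / v))%:E.
pose Vs i w : \bar R := ((V w : 'rV[R]_d) 0%R i)%:E.
have intV i : P.-integrable setT (fun w => (a * s 0%R i)%:E * Vs i w).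
  exact: integrableZl (norm_sub_gaussian_coord_integrable i).
have intr : P.-integrable setT (fun w => r%:E * Q w).
  exact: integrableZl norm_sub_gaussian_integrable.
have intp : P.-integrable setT (fun=> p%:E).
  exact: finite_measure_integrable_cst.
have ints : P.-integrable setT
    (fun w => \sum_(i < d) ((a * s 0%R i)%:E * Vs i w)).
  exact: integrable_sum.
have intsp := integrableD measurableT ints intp.
have intspr := integrableD measurableT intsp intr.
apply: (@le_trans _ _ (\int[P]_w
    (\sum_(i < d) ((a * s 0%R i)%:E * Vs i w) + p%:E + r%:E * Q w))).
  apply: ge0_le_integral => //.
  - apply: (measurable_expR_sqr_norm2 (h := fun w => (s + V w)%R)).
    exact: (measurable_rV_add (h1 := cst (s : borel_rV R d))).
  - by case/integrableP: intspr.
  move=> w _; rewrite sumEFin -EFinM -!EFinD lee_fin.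
  rewrite (le_trans (hpt (V w)))// mulr_sumr.
  by under eq_bigr do rewrite mulrA.
rewrite !integralD// integral_sum// big1; last first.
  move=> i _; rewrite integralZl ?cV ?mule0//.
  exact: norm_sub_gaussian_coord_integrable.
have -> : \int[P]_w p%:E = p%:E.
  by rewrite integral_cst// [X in _ * X](@probability_setT _ _ _ P) mule1.
rewrite add0e integralZl//; last first.
  exact: norm_sub_gaussian_integrable.
by rewrite EFinD leeD2l// EFinM lee_wpmul2l// lee_fin.
Qed.

End SubGaussianStep.

Section BatchNoise.
Context {R : realType} {d : nat} {dO dX : measure_display}.
Context {Omega : measurableType dO} {Xi : measurableType dX}.
Variables (P : probability Omega R) (xi : {RV P >-> Xi}).
Variables (X : nat -> {RV P >-> Xi}).
Variables (N : 'rV[R]_d -> Xi -> 'rV[R]_d) (v : R) (T : nat).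
Hypotheses (mN : jointly_measurable N) (v0 : 0 < v) (iidX : iid_as xi T X).
Hypothesis stepN : forall x s b, 0 <= b -> 2 * b * v <= 1 ->
  (\int[P]_w (expR (b * norm2 (s + N x (xi w)) ^+ 2))%:E <=
  (expR (b * (1 + 16 * b * v) * norm2 s ^+ 2 + b * v))%:E)%E.

Lemma measurable_past_noise n k (x : Omega -> borel_rV R d) : (k < n)%N ->
  measurable_fun [set: past X n] (x : past X n -> _) ->
  measurable_fun [set: past X n]
    (fun w : past X n => (N (x w) (X k w) : borel_rV R d)).
Proof.
move=> kn mx.
apply: (measurableT_comp mN (g := fun w : past X n => (x w, X k w))).
by apply/measurable_fun_pairP; split => //; exact: measurable_past_sample.
Qed.

(** Induction on the number [l] of summands.  Freezing the past at each new
    sample and applying [stepN] trades the coefficient b of the squared norm for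
    b (1 + 16 b v), so that coefficients growing backwards along
    b_l = 1 / (16 v (H + l)) absorb this cost: b_(l+1) (1 + 16 v b_(l+1)) <= b_l.
    After [H] steps the coefficient is still 1 / (32 v H), the scale on which sums
    of [H] independent terms concentrate, and the factors exp(b_l v) multiply to
    at most exp(1 / 16). *)
Lemma noise_sum_exp_moment (m H l : nat) (x : Omega -> borel_rV R d) :
  (0 < H)%N -> (m + l <= T)%N -> (l <= H)%N ->
  measurable_fun [set: past X m] (x : past X m -> _) ->
  (\int[P]_w (expR ((16 * v * (H + l)%:R)^-1 *
     norm2 (\sum_(0 <= j < l) N (x w) (X (m + j)%N w)) ^+ 2))%:E
   <= (expR (l%:R / (16 * H%:R)))%:E)%E.
Proof.
move=> H0 mlT lH mx.
pose S l w : borel_rV R d := \sum_(0 <= j < l) N (x w) (X (m + j)%N w).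
pose b l : R := (16 * v * (H + l)%:R)^-1.
rewrite -/(b l).
have HR0 : 0 < H%:R :> R by rewrite ltr0n.
elim: l mlT lH => [|l IH] mlT lH.
  rewrite mul0r expR0; under eq_integral.
    move=> w _; rewrite big_geq// sqr_norm2 /dotp.
    rewrite big1 ?mulr0 ?expR0; last first.
      by move=> i _; rewrite mxE mulr0.
    over.
  by rewrite integral_cst// mul1e probability_le1.
have Hl0 k : 0 < (H + k)%:R :> R by rewrite ltr0n addn_gt0 H0.
have b0 k : 0 < b k by rewrite invr_gt0 !mulr_gt0.
have mxn : measurable_fun [set: past X (m + l)] (x : past X (m + l) -> _).
  by apply: measurable_past_le mx; exact: leq_addr.
have mS : measurable_fun [set: past X (m + l)] (S l : past X (m + l) -> _).
  apply: measurable_rV_sum => j jl.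
  by apply: measurable_past_noise => //; rewrite ltn_add2l.
pose Z w := (x w, S l w).
have mZ : measurable_fun [set: past X (m + l)] (Z : past X (m + l) -> _).
  by apply/measurable_fun_pairP; split.
pose SX := ((borel_rV R d * borel_rV R d) * Xi)%type.
pose phi (z : SX) : \bar R :=
  (expR (b l.+1 * norm2 ((z.1.2 : 'rV[R]_d) + N z.1.1 z.2) ^+ 2))%:E.
have mphi : measurable_fun setT phi.
  apply: (measurable_expR_sqr_norm2
    (h := fun z : SX => ((z.1.2 : 'rV[R]_d) + N z.1.1 z.2 : 'rV[R]_d))).
  apply: measurable_rV_add.
    exact: (measurableT_comp measurable_snd measurable_fst).
  apply: (measurableT_comp mN (g := fun z : SX => (z.1.1, z.2))).
  apply/measurable_fun_pairP; split => /=; last exact: measurable_snd.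
  exact: (measurableT_comp measurable_fst measurable_fst).
have := freezing (n := m + l) _ iidX mZ mphi (fun z => expR_ge0 _).
rewrite -addnS mlT => /(_ isT) frz.
rewrite [leLHS](_ : _ = (\int[P]_w phi (Z w, X (m + l)%N w))%E); last first.
  by apply: eq_integral => w _; rewrite big_nat_recr.
rewrite frz.
pose n : R := (H + l)%:R; pose c := b l.+1 * v.
have n0 : 0 < n by exact: Hl0.
have c0 : 0 < c by rewrite mulr_gt0.
have nS : (H + l.+1)%:R = n + 1 :> R by rewrite addnS -natr1.
have Hn : H%:R <= n by rewrite ler_nat leq_addr.
have cE : 16 * c * (n + 1) = 1.
  by rewrite /c /b nS; field; rewrite !gt_eqF// addr_gt0.
have bv1 : 2 * b l.+1 * v <= 1 by rewrite -mulrA -/c; nra.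
(* with e = 16 c = 1 / (n + 1), the claim reads
   n e (1 + e) = (1 - e) (1 + e) <= 1 *)
have bstep : b l.+1 * (1 + 16 * b l.+1 * v) <= b l.
  rewrite /(b l) -[leRHS]mul1r ler_pdivlMr ?mulr_gt0// -/n.
  rewrite [leLHS](_ : _ = 16 * c * n * (1 + 16 * c)); last by rewrite /c; ring.
  nra.
have bvH : b l.+1 * v <= 1 / (16 * H%:R).
  by rewrite ler_pdivlMr ?mulr_gt0// -/c; nra.
have mI : measurable_fun setT (fun z => \int[P]_w phi (z, xi w))%E.
  apply: (measurable_fun_fubini_tonelli_F (m2 := P)
    (fun z : _ * Omega => phi (z.1, xi z.2))); last first.
    by move=> z; rewrite lee_fin expR_ge0.
  apply: (measurableT_comp mphi (g := fun z : _ * Omega => (z.1, xi z.2))).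
  apply/measurable_fun_pairP; split => /=; first exact: measurable_fst.
  by apply: (measurableT_comp _ measurable_snd); exact: measurable_funP.
have mZO : measurable_fun setT Z by exact: measurable_past_sub mZ.
have mlT' : (m + l <= T)%N by apply: leq_trans mlT; rewrite leq_add2l.
have IHl := IH mlT' (ltnW lH).
have mSO : measurable_fun setT (S l) by exact: measurable_past_sub mS.
pose k := expR (1 / (16 * H%:R)) : R.
have k0 : (0 <= k%:E)%E by rewrite lee_fin expR_ge0.
apply: (@le_trans _ _ (\int[P]_w
    (k%:E * (expR (b l * norm2 (S l w : 'rV[R]_d) ^+ 2))%:E))%E).
  apply: ge0_le_integral => //.
  - by move=> w _; apply: integral_ge0 => z _; rewrite lee_fin expR_ge0.
  - exact: (measurableT_comp mI mZO).
  - by apply: measurable_funeM; exact: measurable_expR_sqr_norm2.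
  move=> w _; rewrite (le_trans (stepN _ _ (ltW (b0 l.+1)) bv1))//.
  rewrite -EFinM lee_fin -expRD ler_expR addrC lerD//.
  by rewrite ler_wpM2r ?sqr_ge0.
rewrite ge0_integralZl//; last exact: measurable_expR_sqr_norm2.
apply: (@le_trans _ _ (k%:E * (expR (l%:R / (16 * H%:R)))%:E)%E).
  by rewrite lee_wpmul2l.
by rewrite -EFinM /k -expRD lee_fin ler_expR -mulrDl -[in leRHS]natr1 addrC.
Qed.

End BatchNoise.

(** * Batched SGD as a random process *)

Section SGDMeasurability.
Context {R : realType} {d : nat} {dO dX : measure_display}.
Context {Omega : measurableType dO} {Xi : measurableType dX}.
Variables (P : probability Omega R) (X : nat -> {RV P >-> Xi}).

Lemma jointly_measurable_sub_gradient (f : 'rV[R]_d -> R) L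
    (g : 'rV[R]_d -> Xi -> 'rV[R]_d) :
  smooth L f -> jointly_measurable g ->
  jointly_measurable (fun x y => g x y - gradient f x).
Proof.
move=> sm mg; apply: measurable_rV_sub => //.
have mgrad : measurable_fun [set: borel_rV R d]
    (gradient f : borel_rV R d -> borel_rV R d).
  apply: measurable_borel_rV => i; apply: continuous_measurable_rV.
  exact: smooth_gradient_coord_continuous sm.
exact: (measurableT_comp mgrad measurable_fst).
Qed.

Lemma measurable_past_batched_sgd (g : 'rV[R]_d -> Xi -> 'rV[R]_d)
    alpha H x0 k :
  jointly_measurable g ->
  measurable_fun [set: past X (k * H)]
    (fun w : past X (k * H) =>
       (batched_sgd g alpha H x0 (fun i => X i w) k : borel_rV R d)).
Proof.
move=> mg; elim: k => [|k IH] /=; first exact: measurable_cst.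
have mx : measurable_fun [set: past X (k.+1 * H)]
    (fun w : past X (k.+1 * H) =>
       (batched_sgd g alpha H x0 (fun i => X i w) k : borel_rV R d)).
  by apply: measurable_past_le IH; rewrite leq_mul2r leqnSn orbT.
apply: measurable_rV_sub => //; do 2 apply: measurable_rV_scale.
apply: measurable_rV_sum => l lH; apply: measurable_past_noise => //.
by rewrite mulSn addnC ltn_add2r.
Qed.

End SGDMeasurability.

Section StochasticGradient.
Context {R : realType} {d : nat} {dO dX : measure_display}.
Context {Omega : measurableType dO} {Xi : measurableType dX}.
Variables (P : probability Omega R) (xi : {RV P >-> Xi}).
Variables (X : nat -> {RV P >-> Xi}).
Variables (f : 'rV[R]_d -> R) (g : 'rV[R]_d -> Xi -> 'rV[R]_d) (L v : R).
Hypotheses (mg : jointly_measurable g) (smf : smooth L f) (v0 : 0 < v).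
Hypothesis unbiased : forall x (i : 'I_d),
  ('E_P[fun w => g x (xi w) ord0 i] = (gradient f x ord0 i)%:E)%E.
Hypothesis sub_gaussian : forall x,
  ('E_P[(fun w => expR (norm2 (g x (xi w) - gradient f x) ^+ 2 / v))%R]
     <= (expR 1)%:E)%E.

Let N x y := g x y - gradient f x.
Let mN : jointly_measurable N := jointly_measurable_sub_gradient smf mg.

Lemma gradient_noise_step x s b : 0 <= b -> 2 * b * v <= 1 ->
  (\int[P]_w (expR (b * norm2 (s + N x (xi w)) ^+ 2))%:E <=
  (expR (b * (1 + 16 * b * v) * norm2 s ^+ 2 + b * v))%:E)%E.
Proof.
have mNx : measurable_fun setT (fun w => N x (xi w) : borel_rV R d).
  apply: (measurableT_comp mN (g := fun w => ((x : borel_rV R d), xi w))).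
  apply/measurable_fun_pairP.
  by split; [exact: measurable_cst|exact: measurable_funP].
have sgN : (\int[P]_w (expR (norm2 (N x (xi w)) ^+ 2 / v))%:E
    <= (expR 1)%:E)%E.
  by have := sub_gaussian x; rewrite unlock.
apply: (integral_expR_sqr_norm2_add_le mNx v0 sgN) => i.
have intN := norm_sub_gaussian_coord_integrable mNx v0 sgN i.
have := unbiased x i; rewrite unlock.
rewrite (_ : (fun w => _) =
  (fun w => (N x (xi w) 0 i)%:E + (gradient f x 0 i)%:E)%E); last first.
  by apply/funext => w; rewrite /N !mxE -EFinD subrK.
rewrite integralD//; last exact: finite_measure_integrable_cst.
rewrite integral_cst// [X in (_ * X)%E](@probability_setT _ _ _ P) mule1 => h.
have fN := integrable_fin_num measurableT intN.
move: h; rewrite -(fineK fN) -EFinD => -[h]; congr EFin.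
by apply: (addIr (gradient f x 0 i)); rewrite h add0r.
Qed.

Variables (alpha : R) (H : nat) (x0 : 'rV[R]_d).
Hypothesis H0 : (0 < H)%N.

Definition sgd_iterate (k : nat) (w : Omega) : 'rV[R]_d :=
  batched_sgd g alpha H x0 (fun i => X i w) k.

Definition batch_error (k : nat) (w : Omega) : 'rV[R]_d :=
  batch_gradient g H (fun i => X i w) k (sgd_iterate k w) -
  gradient f (sgd_iterate k w).

Lemma batch_errorE k w : batch_error k w =
  H%:R^-1 *: \sum_(0 <= l < H) N (sgd_iterate k w) (X (k * H + l)%N w).
Proof.
rewrite /batch_error /batch_gradient sumrB scalerBr; congr (_ - _).
rewrite sumr_const_nat subn0 -[X in _ *: X]scaler_nat scalerA mulVf ?scale1r//.
by rewrite pnatr_eq0 -lt0n.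
Qed.

Lemma measurable_sgd_iterate k :
  measurable_fun [set: Omega] (sgd_iterate k : Omega -> borel_rV R d).
Proof.
exact: (measurable_past_sub
  (measurable_past_batched_sgd (X := X) alpha (H := H) (k := k) x0 mg)).
Qed.

Lemma measurable_batch_error k :
  measurable_fun [set: Omega] (batch_error k : Omega -> borel_rV R d).
Proof.
rewrite (funext (batch_errorE k)).
apply: measurable_rV_scale; apply: measurable_rV_sum => l _.
apply: (measurableT_comp mN
  (g := fun w => ((sgd_iterate k w : borel_rV R d), X (k * H + l)%N w))).
apply/measurable_fun_pairP.
by split; [exact: measurable_sgd_iterate|exact: measurable_funP].
Qed.

(** The iterate entering batch [k] is random, but it depends only on the samples
    of earlier batches, so it is part of the past that [noise_sum_exp_moment]
    freezes.  The factor 1 / H in the batch mean turns the coefficient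
    1 / (32 v H) for the sum into H / (32 v). *)
Lemma batch_error_exp_moment T k : iid_as xi T X -> (k * H + H <= T)%N ->
  (\int[P]_w (expR (H%:R / (32 * v) * norm2 (batch_error k w) ^+ 2))%:E
    <= 2%:E)%E.
Proof.
move=> iidX kHT.
have := noise_sum_exp_moment mN v0 iidX gradient_noise_step H0 kHT (leqnn H)
  (measurable_past_batched_sgd alpha (k := k) x0 mg).
have HR0 : 0 < H%:R :> R by rewrite ltr0n.
have -> : H%:R / (16 * H%:R) = 16^-1 :> R by field; rewrite gt_eqF.
move=> h; apply: (@le_trans _ _ (expR (16^-1 : R))%:E).
  apply: le_trans h; rewrite le_eqVlt; apply/orP; left; apply/eqP.
  apply: eq_integral => w _; rewrite batch_errorE !sqr_norm2 !dotpE natrD.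
  by congr (expR _)%:E; field; rewrite !gt_eqF// addr_gt0.
rewrite lee_fin; have := expR_ge1Dx (- 16^-1 : R); rewrite expRN => h1.
have e0 := expR_gt0 (16^-1 : R).
by have := ler_wpM2l (ltW e0) h1; rewrite divff ?gt_eqF//; lra.
Qed.

End StochasticGradient.

(** Exponential moments of [K] variables are summed before a single use of
    Markov's inequality; this is the union bound over the batches. *)
Lemma sum_expR_tail {R : realType} {dO : measure_display}
    {Omega : measurableType dO} (P : probability Omega R) (K : nat)
    (Y : nat -> Omega -> R) (delta : R) :
  (0 < K)%N -> 0 < delta ->
  (forall k, measurable_fun [set: Omega] (Y k)) ->
  (forall k, (k < K)%N -> (\int[P]_w (expR (Y k w))%:E <= 2%:E)%E) ->
  let bad := [set w | 2 * K%:R / delta <= \sum_(k < K) expR (Y k w)] in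
  measurable bad /\ (P bad <= delta%:E)%E.
Proof.
move=> K0 delta0 mY Y_le2 bad.
pose G w := \sum_(k < K) expR (Y k w); pose a := 2 * K%:R / delta.
have mG : measurable_fun setT G.
  by apply: measurable_sum => k; exact: measurableT_comp.
have a0 : 0 < a by rewrite divr_gt0// mulr_gt0 ?ltr0n.
split.
  rewrite [X in measurable X](_ : _ = setT `&` G @^-1` `[a, +oo[%classic).
    by apply: mG => //; exact: measurable_itv.
  by apply/seteqP; split => w /=; rewrite in_itv/= andbT// => -[].
have G_le : (\int[P]_w (G w)%:E <= (2 * K%:R)%:E)%E.
  under eq_integral do rewrite -sumEFin.
  have mEY k : measurable_fun setT (fun w => (expR (Y k w))%:E).
    by apply/measurable_EFinP; exact: measurableT_comp.
  rewrite ge0_integral_sum//.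
  apply: (@le_trans _ _ (\sum_(k < K) 2%:E)%E).
    by apply: lee_sum => k _; exact: Y_le2.
  by rewrite sumEFin sumr_const card_ord mulr_natr.
have absG w : `|(EFin \o G) w|%E = (G w)%:E.
  by rewrite gee0_abs// lee_fin; apply: sumr_ge0 => k _; exact: expR_ge0.
have mEG : measurable_fun setT (EFin \o G) by exact/measurable_EFinP.
have := @le_integral_abse _ _ _ P _ measurableT _ a mEG a0.
under eq_integral do rewrite absG.
under eq_set do rewrite absG lee_fin.
rewrite setTI => h; have := le_trans h G_le.
rewrite [(2 * K%:R)%:E](_ : _ = (a%:E * delta%:E)%E); last first.
  by rewrite -EFinM /a divfK// gt_eqF.
by rewrite lee_pmul2l.
Qed.

(** * The convergence rate *)

Section Rate.
Context {R : realType}.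

Lemma expr_one_sub_le (t : R) K : t <= 1 -> (1 - t) ^+ K <= expR (- (t * K%:R)).
Proof.
move=> t1; rewrite mulrC -mulrN expRM_natl.
rewrite lerXn2r ?nnegrE ?expR_ge0 ?subr_ge0//.
exact: expR_ge1Dx.
Qed.

(** The choice of [K] makes the contraction over all steps at most
    exp(- 2 ln T), and turns 1 / H = K / T into kappa ln T / T. *)
Lemma batched_rate_le (mu L v delta r0 : R) (d T K H : nat) :
  0 < mu -> mu <= L -> 0 < v -> 0 < delta -> 0 <= r0 ->
  (0 < d)%N -> (0 < K)%N -> (0 < H)%N -> T = (K * H)%N ->
  K%:R = 4 * (L / mu) * ln (T%:R : R) ->
  (1 - mu / (2 * L)) ^+ K * r0 +
    32 * v / H%:R * ln (2 * K%:R / delta) / (2 * mu) <=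
  r0 / T%:R + 16 * 2 ^+ 2 * (L / mu) * v / (mu * T%:R) * ln (T%:R)
     * ln (2 * d%:R * T%:R / delta).
Proof.
move=> mu0 muL v0 delta0 r00 d0 K0 H0 TKH KE.
have L0 : 0 < L by exact: lt_le_trans muL.
have T0 : (0 < T)%N by rewrite TKH muln_gt0 K0.
have TR0 : 0 < T%:R :> R by rewrite ltr0n.
have HR0 : 0 < H%:R :> R by rewrite ltr0n.
have KR0 : 0 < K%:R :> R by rewrite ltr0n.
have lnT0 : 0 <= ln (T%:R : R) by rewrite ln_ge0// ler1n.
apply: lerD.
  rewrite mulrC ler_wpM2l//.
  have muL1 : mu / (2 * L) <= 1 by rewrite ler_pdivrMr ?mulr_gt0// mul1r; lra.
  apply: (le_trans (expr_one_sub_le K muL1)).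
  rewrite -[leRHS](@lnK _ (T%:R^-1)) ?posrE ?invr_gt0//.
  rewrite ler_expR lnV ?posrE// lerN2.
  rewrite KE [leRHS](_ : _ = 2 * ln T%:R); last by field; rewrite !gt_eqF.
  lra.
have -> : 16 * 2 ^+ 2 * (L / mu) * v / (mu * T%:R) * ln (T%:R : R) =
    32 * v / H%:R / (2 * mu).
  rewrite [LHS](_ : _ =
    16 * v / (mu * T%:R) * (4 * (L / mu) * ln (T%:R : R))); last first.
    by field; rewrite !gt_eqF.
  by rewrite -KE TKH natrM; field; rewrite !gt_eqF.
rewrite -!mulrA (mulrC (ln _)) !mulrA ler_wpM2l//.
  by rewrite divr_ge0 ?divr_ge0 ?mulr_ge0 ?ltW.
have dR : 1 <= d%:R :> R by rewrite ler1n.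
have KT : K%:R <= T%:R :> R by rewrite ler_nat TKH leq_pmulr.
rewrite ler_ln ?posrE ?divr_gt0 ?mulr_gt0 ?ltr0n//.
rewrite ler_pM2r ?invr_gt0// -mulrA ler_pM2l// (le_trans KT)//.
by rewrite ler_peMl.
Qed.

End Rate.

(* MathComp-Analysis *)
Theorem theorem1 (R : realType) :
  exists2 c : R, 0 < c &
  forall (d : nat) (dO dX : measure_display)
    (Omega : measurableType dO) (Xi : measurableType dX)
    (P : probability Omega R) (xi : {RV P >-> Xi}) (xis : nat -> {RV P >-> Xi})
    (f : 'rV[R]_d -> R) (g : 'rV[R]_d -> Xi -> 'rV[R]_d)
    (xstar x0 : 'rV[R]_d) (L mu sigma delta : R) (T K H : nat),
  (0 < d)%N ->
  (forall x, differentiable f x) ->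
  minimizer f xstar ->
  jointly_measurable g ->
  smooth L f ->
  0 < mu -> strongly_convex mu f ->
  (forall x (i : 'I_d),
     'E_P[fun w => g x (xi w) ord0 i] = (gradient f x ord0 i)%:E)%E ->
  0 < sigma ^+ 2 ->
  (forall x,
     'E_P[(fun w => expR (norm2 (g x (xi w) - gradient f x) ^+ 2 / sigma ^+ 2))%R]
     <= (expR 1)%:E)%E ->
  0 < delta < 1 ->
  (0 < K)%N -> (0 < H)%N -> T = (K * H)%N ->
  iid_as xi T xis ->
  let kappa := L / mu in
  K%:R = 4 * kappa * ln (T%:R : R) ->
  let alpha := 1 / (2 * L) in
  let r (k : nat) (w : Omega) : R :=
    f (batched_sgd g alpha H x0 (fun i => xis i w) k) - f xstar in
  ((1 - delta)%:E <=
   P [set w | r K w <=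
        r 0%N w / T%:R
        + 16 * c ^+ 2 * kappa * sigma ^+ 2 / (mu * T%:R)
          * ln (T%:R) * ln (2 * d%:R * T%:R / delta)]%R)%E.
Proof.
exists 2 => // d dO dX Omega Xi P xi X f g xstar x0 L mu sigma delta T K H.
move=> d0 df minf mg smf mu0 scf unbiased v0 sub_gaussian /andP[delta0 delta1].
move=> K0 H0 TKH iidX kappa KE /=; pose alpha := 1 / (2 * L); rewrite -/alpha.
have muL : mu <= L by exact: strongly_convex_le_smooth smf scf d0.
have L0 : 0 < L by exact: lt_le_trans muL.
set v := sigma ^+ 2 in v0 sub_gaussian *.
pose e k w := batch_error X f g alpha H x0 k w.
pose Y k w := H%:R / (32 * v) * norm2 (e k w) ^+ 2.
have mY k : measurable_fun setT (Y k).
  apply: measurable_funM => //; apply: (measurable_sqr_norm2 (h := e k)).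
  exact: (measurable_batch_error X mg smf alpha x0 H0 k).
have Y_le2 k : (k < K)%N -> (\int[P]_w (expR (Y k w))%:E <= 2%:E)%E.
  move=> kK.
  apply: (batch_error_exp_moment mg smf v0 unbiased sub_gaussian alpha x0 H0
    iidX).
  by rewrite TKH -mulSnr leq_mul2r kK orbT.
have [mbad Pbad] := sum_expR_tail K0 delta0 mY Y_le2.
set bad := [set w | _] in mbad Pbad.
set C := (X in [set w | _ <= X]).
apply: (@le_trans _ _ (P (~` bad))).
  by rewrite probability_setC// EFinB leeB.
have mx := measurable_sgd_iterate X mg alpha H x0 K.
apply: le_measure; rewrite ?inE//.
- exact: measurableC.
- rewrite [X in measurable X](_ : _ = setT `&`
    (fun w => f (sgd_iterate X g alpha H x0 K w)) @^-1`
      `]-oo, C + f xstar]%classic); last first.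
    by apply/seteqP; split => w /=; rewrite in_itv/= lerBlDr// => -[].
  apply: (measurableT_comp (continuous_measurable_rV _) mx) => //.
  by move=> y; exact: differentiable_continuous.
move=> w /= /negP; rewrite -ltNge => good; rewrite /C.
set a := 2 * K%:R / delta in good.
have a1 : 1 <= a.
  rewrite ler_pdivlMr// mul1r.
  have : 1 <= K%:R :> R by rewrite ler1n.
  lra.
have HR0 : 0 < H%:R :> R by rewrite ltr0n.
have r00 : 0 <= f x0 - f xstar by rewrite subr_ge0.
apply: le_trans (batched_rate_le mu0 muL v0 delta0 r00 d0 K0 H0 TKH KE).
apply: (batched_sgd_gap_le smf mu0 scf) => //.
  apply: mulr_ge0; last exact: ln_ge0.
  by apply/ltW; rewrite divr_gt0 ?(mulr_gt0 _ v0).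
move=> k kK.
have Yk : expR (Y k w) <= a.
  apply: le_trans (ltW good); rewrite (bigD1 (Ordinal kK))//= lerDl.
  by apply: sumr_ge0 => j _; exact: expR_ge0.
have : H%:R / (32 * v) * norm2 (e k w) ^+ 2 <= ln a.
  by rewrite -ler_expR lnK ?posrE// (lt_le_trans ltr01).
rewrite mulrC -ler_pdivlMr ?divr_gt0 ?(mulr_gt0 _ v0)// => /le_trans; apply.
by rewrite invf_div mulrC.
Qed.
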